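(* There is an absolute constant $c_0>0$ such that for every odd prime power $q$ the following holds: if $C_1,\dots,C_\ell$ are geometrically irreducible plane conics defined over $\mathbb{F}_q$ and $\ell< c_0\log q$, then $\bigcup_{i=1}^{\ell} C_i(\mathbb{F}_q)$ is not a blocking set in $\mathbb{P}^2(\mathbb{F}_q)$.
   Context: $\mathbb{F}_q$ is the finite field with $q$ elements and $\overline{\mathbb{F}_q}$ its algebraic closure. A set $B\subseteq\mathbb{P}^2(\mathbb{F}_q)$ is a blocking set if it intersects every $\mathbb{F}_q$-line of $\mathbb{P}^2$ (i.e. every line defined over $\mathbb{F}_q$). A plane curve over $\mathbb{F}_q$ is geometrically irreducible if it is irreducible over $\overline{\mathbb{F}_q}$. A conic is a plane curve of degree $2$. $\log$ is the natural logarithm. *)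

(* Defs.v *)
From HB Require Import structures.
From mathcomp Require Import all_boot all_order all_algebra all_field.
From mathcomp Require Import mpoly.
From mathcomp Require Import classical_sets.

Set Implicit Arguments.
Unset Strict Implicit.
Unset Printing Implicit Defensive.

Import GRing.Theory.
Local Open Scope classical_set_scope.
Local Open Scope ring_scope.

(* The points of P^2(F) are the lines through the origin of F^3. *)
Definition proj_point (F : fieldType) : Type :=
  {p : {vspace 'rV[F]_3} | \dim p == 1%N}.

(* Proportional equations define the same curve; nothing below distinguishes
   them. *)
Record plane_curve (F : fieldType) (d : nat) : Type := PlaneCurve {
  curve_eqn :> {mpoly F[3]};
  curve_homog : curve_eqn \is d.-homog;
  curve_neq0 : curve_eqn != 0 }.

Definition proj_line (F : fieldType) : Type := plane_curve F 1.
Definition conic (F : fieldType) : Type := plane_curve F 2.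

(* By homogeneity, all the homogeneous coordinates v of p agree on whether they
   are a zero of C; the vector v = 0 of p imposes nothing when d > 0. *)
Definition rational_points (F : fieldType) (d : nat) (C : plane_curve F d) :
    set (proj_point F) :=
  [set p : proj_point F | forall v : 'rV[F]_3, v \in sval p -> C.@[v 0] = 0].

Definition blocking_set (F : fieldType) (B : set (proj_point F)) : Prop :=
  forall L : proj_line F, B `&` rational_points L !=set0.

Definition alg_closure (F : countFieldType) : countClosedFieldType :=
  tag (countable_algebraic_closure F).

Definition to_alg_closure (F : countFieldType) :
    {rmorphism F -> alg_closure F} :=
  sval (tagged (countable_algebraic_closure F)).

Definition irreducible_elt (A : idomainType) (f : A) : Prop :=
  [/\ f != 0, f \isn't a GRing.unit &
      forall g h : A, f = g * h -> g \is a GRing.unit \/ h \is a GRing.unit].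

Definition geom_irreducible (F : countFieldType) (d : nat)
    (C : plane_curve F d) : Prop :=
  irreducible_elt (map_mpoly (to_alg_closure F) C).

(* Main.v *)
Require Import Defs.
From mathcomp Require Import all_boot all_order all_algebra all_field.
From mathcomp Require Import mpoly.
From mathcomp Require Import classical_sets reals exp.
From mathcomp Require Import ring zify.

(** At a line meeting the conic C in a rational point, the dual quadratic form
    D of C takes a square value or 0, so it suffices to find a vector u of F^3
    at which the finitely many dual forms D_i all take nonsquare values.
    With chi the quadratic character, sum the product of the 1 - chi(D_i(u))
    over u and expand: the main term is q^3, and the others are the sums over u
    of chi(prod_(i in T) D_i(u)) for nonempty sets T of pairwise non
    proportional forms.  Choose i in T and a point P on D_i = 0 but off the
    other D_j.  Along a line of direction P the product is a polynomial of odd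
    degree 2|T| - 1, and for odd degree Stepanov's method is at its simplest:
    the auxiliary polynomial sum_j (r_j + s_j f^((q-1)/2)) X^(qj) is nonzero
    because its nonzero terms have distinct degrees.  This saves a factor of
    order q^(1/2), which beats the 2^l terms of the expansion. *)

Set Implicit Arguments.
Unset Strict Implicit.
Unset Printing Implicit Defensive.

Import Order.TTheory GRing.Theory Num.Theory.
Local Open Scope ring_scope.

(** * Roots of high multiplicity, sums with distinct degrees, and pigeonhole *)

Lemma dvdp_prod_XsubC_exp (F : fieldType) (p : {poly F}) (M : nat) (s : seq F) :
  uniq s -> (forall x, x \in s -> ('X - x%:P) ^+ M %| p) ->
  (\prod_(x <- s) ('X - x%:P)) ^+ M %| p.
Proof.
elim: s => [|x s IHs] /=; first by rewrite big_nil expr1n dvd1p.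
case/andP=> xs us dvd_p; rewrite big_cons exprMn Gauss_dvdp.
  rewrite dvd_p ?mem_head //=; apply: IHs => // y ys.
  by rewrite dvd_p // inE ys orbT.
by rewrite coprimep_expl ?coprimep_expr // coprimep_sym coprimep_XsubC
  root_prod_XsubC.
Qed.

Lemma high_mult_roots_bound (F : fieldType) (p : {poly F}) (M : nat) (s : seq F) :
  p != 0 -> uniq s -> (forall x, x \in s -> ('X - x%:P) ^+ M %| p) ->
  (size s * M < size p)%N.
Proof.
move=> p0 us dvd_p; have /(dvdp_leq p0) := dvdp_prod_XsubC_exp us dvd_p.
apply: leq_trans; have /prednK <- : (0 < size ((\prod_(x <- s) ('X - x%:P)) ^+ M))%N.
  by rewrite size_poly_gt0 expf_neq0 // monic_neq0 // monic_prod_XsubC.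
by rewrite size_exp size_prod_XsubC.
Qed.

(** The leading coefficient of a nonzero term of largest size could not be cancelled by the other
    terms. *)
Lemma sum_poly_distinct_size (F : fieldType) (I : finType) (t : I -> {poly F}) :
  (forall i j, t i != 0 -> t j != 0 -> size (t i) = size (t j) -> i = j) ->
  \sum_i t i = 0 -> forall i, t i = 0.
Proof.
move=> inj_t sum0 i; apply/eqP; apply: contraT => ti0.
have [j _ max_j] := @arg_maxnP I i predT (fun k => size (t k)) isT.
have tj0 : t j != 0.
  by rewrite -size_poly_gt0 (leq_trans _ (max_j i isT)) // size_poly_gt0.
have := congr1 (fun p : {poly F} => p`_(size (t j)).-1) sum0.
rewrite /= coef0 coef_sum (bigD1 j) //= big1 ?addr0 => [/eqP|k kj].
  by rewrite -/(lead_coef _) lead_coef_eq0 (negPf tj0).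
have [-> | tk0] := eqVneq (t k) 0; first by rewrite coef0.
rewrite nth_default // -ltnS prednK ?size_poly_gt0 //.
have le_kj : (size (t k) <= size (t j))%N := max_j k isT.
rewrite ltn_neqAle le_kj andbT.
by apply: contra kj => /eqP /inj_t ->.
Qed.

(** Counting elements shows that [T] is not injective; by additivity the difference of two vectors
    with the same image is in the kernel. *)
Lemma ker_ffun_neq0 (F : finFieldType) (I K : finType)
    (T : {ffun I -> F} -> {ffun K -> F}) :
  {morph T : u v / u - v} -> (#|K| < #|I|)%N ->
  exists2 u, u != 0 & T u = 0.
Proof.
move=> TB ltKI; have /injectivePn [u [v uv Tuv]] : ~~ injectiveb T.
  apply/injectiveP => /leq_card; rewrite !card_ffun leq_exp2l ?finNzRing_gt1 //.
  by rewrite leqNgt ltKI.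
by exists (u - v); rewrite ?subr_eq0 // TB Tuv subrr.
Qed.

(** * Rescaled Taylor expansions and the degrees of their coefficients *)

Section Weight.

Variables (F : fieldType) (m : nat).

(** [x] has weight 1 and the outer variable [w] has weight [1 - m], so that both summands of
    [x + f(x) w] have weight 1 when [f] has degree [m]. *)
Definition weight_le (n : nat) (P : {poly {poly F}}) :=
  forall k, (size (P`_k)%R <= (n + k * m.-1).+1)%N.

Lemma weight_le_mul a b P Q :
  weight_le a P -> weight_le b Q -> weight_le (a + b) (P * Q).
Proof.
move=> wP wQ k; rewrite coefM (leq_trans (size_sum _ _ _)) //.
apply/bigmax_leqP => i _; apply: leq_trans (size_polyMleq _ _) _.
have ik : (i <= k)%N by rewrite -ltnS.
have -> : (k * m.-1 = i * m.-1 + (k - i) * m.-1)%N by rewrite -mulnDl subnKC.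
have := wP i; have := wQ (k - i)%N.
move: (i * _)%N ((k - i) * _)%N (size _) (size _) => x y sp sq; lia.
Qed.

Lemma weight_le1 : weight_le 0 1.
Proof. by move=> k; rewrite coef1; case: eqP; rewrite ?size_poly1 ?size_poly0. Qed.

Lemma weight_le_exp a P n : weight_le a P -> weight_le (n * a) (P ^+ n).
Proof.
move=> wP; elim: n => [|n IHn]; first exact: weight_le1.
by rewrite exprS mulSn; apply: weight_le_mul.
Qed.

End Weight.

Section Rescaled.

Variables (F : fieldType) (f : {poly F}).

(* [p(x + f(x) w)], a polynomial in [w] over [F[x]].  The rescaling of the
   increment by [f] makes [rescale f] divisible by [f], so that powers of [f]
   stay divisible by [f] after any number of Hasse derivatives. *)
Definition rescale (p : {poly F}) : {poly {poly F}} :=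
  p^:P \Po ('X%:P + f%:P * 'X).

Lemma rescaleM p r : rescale (p * r) = rescale p * rescale r.
Proof. by rewrite /rescale rmorphM comp_polyM. Qed.

Lemma rescaleB p r : rescale (p - r) = rescale p - rescale r.
Proof. by rewrite /rescale rmorphB comp_polyB. Qed.

Lemma rescaleD p r : rescale (p + r) = rescale p + rescale r.
Proof. by rewrite /rescale rmorphD comp_polyD. Qed.

Lemma rescaleXn p n : rescale (p ^+ n) = rescale p ^+ n.
Proof. by rewrite /rescale !rmorphXn. Qed.

Lemma rescale_sum (I : finType) (t : I -> {poly F}) :
  rescale (\sum_i t i) = \sum_i rescale (t i).
Proof. by rewrite /rescale !rmorph_sum. Qed.

Lemma rescaleX : rescale 'X = 'X%:P + f%:P * 'X.
Proof. by rewrite /rescale map_polyX comp_polyX. Qed.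

(* At a root [x] of [X^q - X] with [f(x)^h = a], this is the value at [x] of the
   coefficient of [w^k] in [rescale (\sum_j (r j + s j * f^h) * X^(q j))]
   when [k < q], with [V] the [h]-th power of [rescale f / f]. *)
Definition step_cond (V : {poly {poly F}}) (a : F) J (r s : 'I_J -> {poly F})
    (k : nat) : {poly F} :=
  \sum_(j < J) ((rescale (r j))`_k + a *: (rescale (s j) * V)`_k) * 'X^j.

Lemma step_condB V a J (r s r' s' : 'I_J -> {poly F}) k :
  step_cond V a (fun j => r j - r' j) (fun j => s j - s' j) k =
  step_cond V a r s k - step_cond V a r' s' k.
Proof.
rewrite /step_cond -sumrB; apply: eq_bigr => j _.
by rewrite !rescaleB mulrBl !coefB -!mul_polyC; ring.
Qed.

Lemma eq_step_cond V a J (r s r' s' : 'I_J -> {poly F}) k :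
  r =1 r' -> s =1 s' -> step_cond V a r s k = step_cond V a r' s' k.
Proof. by move=> rr ss; apply: eq_bigr => j _; rewrite rr ss. Qed.

(** In [F[x][y]] the difference [f(y) - f(x)] is a multiple of [y - x], and [y = x + f(x) w] turns
    [y - x] into [f(x) w]. *)
Lemma rescale_self : exists U, rescale f = f%:P * U.
Proof.
have : root (f^:P - f%:P) 'X.
  rewrite rootE hornerD hornerN hornerC subr_eq0; apply/eqP.
  by rewrite -[RHS]comp_polyXr.
case/factor_theorem=> Q defQ.
exists (1 + (Q \Po ('X%:P + f%:P * 'X)) * 'X).
have := congr1 (fun P => P \Po ('X%:P + f%:P * 'X)) defQ.
rewrite comp_polyB comp_polyM comp_polyB comp_polyX !comp_polyC -/(rescale f).
by move=> /eqP; rewrite subr_eq => /eqP ->; ring.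
Qed.

(** Evaluating the coefficients at [x] gives [p(x + c w)] with [c = f(x)]. This is divisible by
    [w^M], and since [c] is nonzero the substitution [w = (X - x) / c] gives back [p]. *)
Lemma dvdp_of_rescale (p : {poly F}) (x : F) (M : nat) :
  f.[x] != 0 -> (forall k, (k < M)%N -> ((rescale p)`_k).[x] = 0) ->
  ('X - x%:P) ^+ M %| p.
Proof.
move=> fx0 coef_p0; set c := f.[x] in fx0.
have eq_comp : map_poly (horner_eval x) (rescale p) = p \Po (x%:P + c%:P * 'X).
  rewrite /rescale map_comp_poly -map_poly_comp map_poly_id => [|a _] /=; last first.
    by rewrite /horner_eval hornerC.
  by rewrite rmorphD rmorphM /= !map_polyC map_polyX /= /horner_eval hornerX.
have [r def_r] : exists r, p \Po (x%:P + c%:P * 'X) = r * 'X^M.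
  exists (drop_poly M (p \Po (x%:P + c%:P * 'X))).
  rewrite -[LHS](poly_take_drop M); rewrite -[RHS]add0r; congr (_ + _).
  apply/polyP=> k; rewrite coef_take_poly coef0; case: ifP => // kM.
  by rewrite -eq_comp coef_map /= /horner_eval coef_p0.
have := congr1 (fun P => P \Po (c^-1%:P * ('X - x%:P))) def_r.
rewrite -comp_polyA comp_polyD comp_polyM !comp_polyC comp_polyX mulrA -polyCM.
rewrite divff // mul1r addrC subrK comp_polyXr => ->.
by rewrite comp_polyM rmorphXn /= comp_polyX exprMn mulrA dvdp_mulIr.
Qed.

Variable m : nat.
Hypothesis size_f : size f = m.+1.
Hypothesis m_gt0 : (0 < m)%N.

Lemma weight_le_rescale (p : {poly F}) n :
  (size p <= n.+1)%N -> weight_le m n (rescale p).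
Proof.
move=> size_p k; rewrite /rescale comp_polyE coef_sum.
rewrite (leq_trans (size_sum _ _ _)) //; apply/bigmax_leqP => i _.
rewrite coefZ; have w1 : weight_le m 1 ('X%:P + f%:P * 'X).
  move=> [|[|j]]; rewrite coefD coefC coefCM coefX /=.
  - by rewrite mulr0 addr0 size_polyX.
  - by rewrite mulr1 add0r size_f; lia.
  - by rewrite mulr0 addr0 size_poly0.
have := weight_le_exp i w1 k; rewrite muln1 => wi.
apply: leq_trans (size_polyMleq _ _) _.
apply: (@leq_trans (i + k * m.-1).+1).
  by rewrite coef_map /= -subn1 leq_subLR leq_add // size_polyC_leq1.
rewrite ltnS leq_add2r -ltnS (leq_trans _ size_p) //.
by apply: leq_trans (ltn_ord i) _; rewrite size_map_polyC.
Qed.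

(** [rescale f] has weight [m], all of which is taken up by the factor [f]. Powers of [U] then have
    weight 0 as well, so the number of conditions imposed in Stepanov's method does not grow with
    the exponent [h]. *)
Lemma weight_le_unit U : rescale f = f%:P * U -> weight_le m 0 U.
Proof.
move=> defU k; have [->|U0] := eqVneq U`_k 0; first by rewrite size_poly0.
have := @weight_le_rescale f m _ k; rewrite size_f leqnn defU coefCM.
have f0 : f != 0 by rewrite -size_poly_gt0 size_f.
by rewrite size_mul // size_f addSn /= -addnS leq_add2l; apply.
Qed.

End Rescaled.

Lemma exprDn_card (F : finFieldType) (x y : {poly {poly F}}) :
  (x + y) ^+ #|F| = x ^+ #|F| + y ^+ #|F|.
Proof.
have [p p_pr charFp] := finPcharP F.
apply: exprDn_pchar; have := card_pprimeChar charFp.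
set n := logn _ _ => cardF; change #|F| with #|pPrimeCharType charFp|.
rewrite cardF pnatX pnatE // !pchar_poly charFp //.
Qed.

(** By Frobenius [(x + f w)^q = x^q + f^q w^q]: below order [q] in [w], powers of [X^q] behave as
    constants. *)
Lemma rescaleXcard (F : finFieldType) (f : {poly F}) j :
  exists S, rescale f ('X^(#|F| * j)) = ('X^(#|F| * j))%:P + S * 'X^#|F|.
Proof.
elim: j => [|j [S IHj]].
  by exists 0; rewrite muln0 expr0 /rescale rmorph1 comp_polyC mul0r addr0.
have -> : rescale f 'X^(#|F| * j.+1) =
          rescale f 'X^(#|F| * j) * rescale f 'X^#|F|.
  by rewrite mulnS addnC exprD rescaleM.
exists (('X^(#|F| * j))%:P * (f ^+ #|F|)%:P
        + S * (('X^#|F|)%:P + (f ^+ #|F|)%:P * 'X^#|F|)).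
rewrite IHj rescaleXn rescaleX exprDn_card exprMn -!rmorphXn mulnS addnC exprD.
by rewrite rmorphM /=; ring.
Qed.

(** * Stepanov's method for the equation [f(x)^h = a] *)

Section Stepanov.

Variables (F : finFieldType) (h m d : nat) (f : {poly F}) (a : F).
Hypothesis card_F : #|F| = h.*2.+1.
Hypothesis size_f : size f = m.*2.+2.
Hypothesis h_eq : h = (m + d)%N.
Hypothesis d_gt0 : (0 < d)%N.

Definition step_poly J (r s : 'I_J -> {poly F}) : {poly F} :=
  \sum_(j < J) (r j + s j * f ^+ h) * 'X^(#|F| * j).

(** The [2 * J * d] coefficients of the [r j] and [s j] are the unknowns. Each of the [M] conditions
    is the vanishing of a polynomial whose size is at most [d + M * m.*2 + J] by the weight
    estimates, so there are fewer equations than unknowns. *)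
Lemma step_cond_solvable U J M : rescale f f = f%:P * U ->
  (M * (d + M * m.*2 + J) < 2 * J * d)%N ->
  exists r s : 'I_J -> {poly F},
    [/\ forall j, (size (r j) <= d)%N /\ (size (s j) <= d)%N,
        exists j, (r j != 0) || (s j != 0) &
        forall k, (k < M)%N -> step_cond f (U ^+ h) a r s k = 0].
Proof.
move=> defU lt_dim; pose D := (d + M * m.*2 + J)%N.
pose I := (bool * 'I_J * 'I_d)%type; pose K := ('I_M * 'I_D)%type.
pose P (u : {ffun I -> F}) b j := rVpoly (\row_i u (b, j, i)).
have PB u v b j : P (u - v) b j = P u b j - P v b j.
  rewrite /P -raddfB; congr rVpoly; apply/rowP => i; rewrite !mxE !ffunE.
  by [].
pose T (u : {ffun I -> F}) : {ffun K -> F} :=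
  [ffun ki : K => (step_cond f (U ^+ h) a (P u true) (P u false) ki.1)`_(ki.2)].
have TB : {morph T : u v / u - v}.
  move=> u v; apply/ffunP => ki; rewrite !ffunE -coefB -step_condB.
  by rewrite (eq_step_cond f (U ^+ h) a ki.1 (PB u v true) (PB u v false)).
have [|u u0 Tu0] := ker_ffun_neq0 TB.
  by rewrite !card_prod !card_ord card_bool; exact: lt_dim.
have size_P b j : (size (P u b j) <= d)%N by apply: size_poly.
exists (P u true), (P u false); split=> [j||k kM].
- by rewrite !size_P.
- have /existsP [[[b j] i] uI] : [exists x, u x != 0].
    apply: contraNT u0 => /existsPn u0; apply/eqP/ffunP => x.
    by rewrite ffunE; apply/eqP; have := u0 x; rewrite negbK.
  exists j.
  have : P u b j != 0.
    apply: contra uI => /eqP /(congr1 (@poly_rV _ d)).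
    by rewrite rVpolyK linear0 => /rowP /(_ i); rewrite !mxE => ->.
  by case: (b) => ->; rewrite ?orbT.
have size_cond : (size (step_cond f (U ^+ h) a (P u true) (P u false) k) <= D)%N.
  rewrite (leq_trans (size_sum _ _ _)) //; apply/bigmax_leqP => j _.
  apply: leq_trans (size_polyMleq _ _) _; rewrite size_polyXn addnS /=.
  have wP b : weight_le m.*2.+1 d.-1 (rescale f (P u b j)).
    by apply: (weight_le_rescale size_f); rewrite // prednK.
  have wU : weight_le m.*2.+1 (h * 0) (U ^+ h).
    exact: (weight_le_exp _ (weight_le_unit size_f isT defU)).
  have w1 := wP true k; have w2 := weight_le_mul (wP false) wU k.
  have kM2 : (k * m.*2 <= M * m.*2)%N by rewrite leq_mul2r ltnW ?orbT.
  rewrite /D leq_add // ?[(j <= J)%N]ltnW // (leq_trans (size_polyD _ _)) //.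
  rewrite geq_max (leq_trans (size_scale_leq _ _)) ?andbT.
    by apply: leq_trans w1 _; rewrite -addSn prednK // leq_add2l.
  by apply: leq_trans w2 _; rewrite muln0 addn0 -addSn prednK // leq_add2l.
apply/polyP=> i; rewrite coef0.
have [iD | Di] := ltnP i D; last by rewrite nth_default // (leq_trans size_cond).
by have /ffunP /(_ (Ordinal kM, Ordinal iD)) := Tu0; rewrite !ffunE.
Qed.

(** At such an [x], the relations [f(x)^h = a] and [x^q = x] turn the coefficient of [w^k] into the
    value of [step_cond] at [x]; moreover [f(x)] is nonzero because [a] is. *)
Lemma step_poly_vanish U J M (r s : 'I_J -> {poly F}) x :
  rescale f f = f%:P * U -> (M <= #|F|)%N ->
  (forall k, (k < M)%N -> step_cond f (U ^+ h) a r s k = 0) ->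
  a != 0 -> (0 < h)%N -> f.[x] ^+ h = a ->
  ('X - x%:P) ^+ M %| step_poly r s.
Proof.
move=> defU Mq cond0 a0 h0 fxa; apply: (@dvdp_of_rescale _ f).
  by apply: contraNneq a0 => fx0; rewrite -fxa fx0 expr0n gtn_eqF.
move=> k kM; have := congr1 (fun p => p.[x]) (cond0 k kM); rewrite horner0.
move=> <-; rewrite /step_poly rescale_sum coef_sum !horner_sum.
apply: eq_bigr => j _; have [S eqS] := rescaleXcard f j.
rewrite rescaleM rescaleD rescaleM rescaleXn defU exprMn eqS.
have kq := leq_trans kM Mq.
have coef_k A B : (A * (B%:P + S * 'X^#|F|))`_k = A`_k * B.
  by rewrite mulrDr mulrA coefD coefMXn kq addr0 coefMC.
rewrite coef_k coefD -rmorphXn mulrCA coefCM.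
by rewrite !(hornerM, hornerD, hornerZ, hornerXn, horner_exp) exprM expf_card fxa.
Qed.

Lemma size_fh : size (f ^+ h) = (#|F| * m + d).+1.
Proof.
have f0 : f != 0 by rewrite -size_poly_gt0 size_f.
by rewrite -[LHS]prednK ?size_poly_gt0 ?expf_neq0 // size_exp size_f; nia.
Qed.

(** Since [f ^+ h] has degree [q m + d], the degrees of the terms with [r] lie in [[0, d)] modulo
    [q] and those of the terms with [s] in [[d, 2d)], where [2d < q]. The residue thus tells the two
    kinds apart, and the quotient by [q] recovers [j]. *)
Lemma step_poly_neq0 J (r s : 'I_J -> {poly F}) :
  (forall j, (size (r j) <= d)%N /\ (size (s j) <= d)%N) ->
  (exists j, (r j != 0) || (s j != 0)) -> step_poly r s != 0.
Proof.
move=> size_rs [j0 rs0]; have f0 : f != 0 by rewrite -size_poly_gt0 size_f.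
pose t (bj : bool * 'I_J) :=
  (if bj.1 then r bj.2 else s bj.2 * f ^+ h) * 'X^(#|F| * bj.2).
have step_sum : step_poly r s = \sum_bj t bj.
  rewrite -(pair_bigA _ (fun b j => t (b, j))) exchange_big /=.
  by apply: eq_bigr => j _; rewrite big_bool /t /= -mulrDl.
have fh0 : f ^+ h != 0 by rewrite expf_neq0.
have inj_t i j : t i != 0 -> t j != 0 -> size (t i) = size (t j) -> i = j.
  have size_t b k : t (b, k) != 0 -> exists2 n, (n < d)%N &
      size (t (b, k)) = (if b then n + #|F| * k else (n + d) + #|F| * (k + m)).+1%N.
    rewrite /t /= mulf_eq0 negb_or => /andP[t0 _].
    rewrite size_mulXn //; have [szr szs] := size_rs k; case: b t0 => t0.
      exists (size (r k)).-1; rewrite ?prednK ?size_poly_gt0 //.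
      by rewrite -addSn prednK ?size_poly_gt0 // addnC.
    move: t0; rewrite mulf_eq0 negb_or => /andP[s0 _].
    exists (size (s k)).-1; rewrite ?prednK ?size_poly_gt0 //.
    rewrite size_mul // size_fh addnS /= -!addSn prednK ?size_poly_gt0 //.
    by rewrite mulnDr; move: (#|F| * k)%N (#|F| * m)%N (size (s k)); lia.
  have modq n k : (n < d.*2)%N -> ((n + #|F| * k) %% #|F| = n)%N.
    by move=> nd; rewrite addnC mulnC modnMDl modn_small //; lia.
  have divq n k : (n < d.*2)%N -> ((n + #|F| * k) %/ #|F| = k)%N.
    move=> nd; rewrite addnC mulnC divnMDl ?card_F // divn_small ?addn0 //; lia.
  case: i j => [b i] [c j] /size_t [x xd ->] /size_t [y yd ->] [].
  case: b; case: c => eq_sz; have := congr1 (modn^~ #|F|) eq_sz;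
    have := congr1 (divn^~ #|F|) eq_sz; rewrite /= ?modq ?divq; try lia.
  - by move/val_inj ->.
  - by move/addIn/val_inj ->.
rewrite step_sum; apply: contraTneq rs0 => /(sum_poly_distinct_size inj_t) t0.
have Xn0 n : 'X^n != 0 :> {poly F} by rewrite monic_neq0 ?monicXn.
have := t0 (true, j0); have := t0 (false, j0); rewrite /t /=.
move/eqP; rewrite !mulf_eq0 (negPf fh0) (negPf (Xn0 _)) !orbF => ->.
by move/eqP; rewrite mulf_eq0 (negPf (Xn0 _)) orbF => ->.
Qed.

Lemma size_step_poly J (r s : 'I_J -> {poly F}) :
  (forall j, (size (r j) <= d)%N /\ (size (s j) <= d)%N) ->
  (size (step_poly r s) <= #|F| * (J + m))%N.
Proof.
move=> size_rs; rewrite (leq_trans (size_sum _ _ _)) //.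
apply/bigmax_leqP => j _; have [szr szs] := size_rs j.
apply: leq_trans (size_polyMleq _ _) _; rewrite size_polyXn addnS /=.
have sz1 : (size (r j + s j * f ^+ h)%R <= d.*2 + #|F| * m)%N.
  apply: leq_trans (size_polyD _ _) _; rewrite geq_max; apply/andP; split; first lia.
  by apply: leq_trans (size_polyMleq _ _) _; rewrite size_fh; lia.
have : (#|F| * j.+1 <= #|F| * J)%N by rewrite leq_mul2l ltn_ord orbT.
rewrite mulnS mulnDr; have : (d.*2 <= #|F|)%N by lia.
move: sz1; move: (#|F| * j)%N (#|F| * m)%N (#|F| * J)%N (size _) => x y z t.
lia.
Qed.

(** In other words there are at most [q/2 + (5m + 2) q / (2N)] solutions: the excess over [q/2]
    saves a factor [N]. *)
Lemma stepanov N : a != 0 -> (N ^ 2 * 2 <= h)%N -> (m.*2 + N.*2 <= h)%N ->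
  (0 < N)%N ->
  (#|[set x | f.[x] ^+ h == a]| * N.*2 <= (N + 5 * m + 2) * #|F|)%N.
Proof.
move=> a0 N2h mNh N0; have h0 : (0 < h)%N by lia.
have [U defU] := rescale_self f.
(* With vanishing order [M = 2N] and [J = N + 4m + 2], the system is solvable as soon as
   [N^2 + N <= d], which the two bounds on [N] imply. *)
have [|r [s [szrs nz0 cond0]]] := @step_cond_solvable U (N + 4 * m + 2) N.*2 defU.
  have h2 : (h <= 2 * d - 2 * N)%N by lia.
  have := leq_mul (leqnn (4 * m + 2)) (leq_trans N2h h2).
  have : (2 * N <= 2 * d)%N by lia.
  have : (0 < N ^ 2)%N by rewrite expn_gt0 N0.
  nia.
have R0 := step_poly_neq0 szrs nz0.
have := @high_mult_roots_bound _ _ N.*2 (enum [set x | f.[x] ^+ h == a]) R0 (enum_uniq _).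
rewrite -cardE => /(_ _) /leq_trans H; apply: ltnW; apply: H.
  move=> x; rewrite mem_enum inE => /eqP fxa.
  apply: (step_poly_vanish defU _ cond0 a0 h0 fxa); nia.
apply: leq_trans (size_step_poly szrs) _; nia.
Qed.

End Stepanov.

(** * The quadratic character, by Euler's criterion, and its sums over values of a polynomial *)

Definition qchar (F : finFieldType) (x : F) : int :=
  if x == 0 then 0 else if x ^+ #|F|./2 == 1 then 1 else -1.

Section QuadraticCharacter.

Variable F : finFieldType.
Hypothesis odd_F : odd #|F|.

Lemma finField_two_neq0 : (2 : F) != 0.
Proof.
apply/negP => two0.
have [p p_pr charFp] := finPcharP F.
have charF2 : 2 \in [char F] by rewrite inE /=.
have cardF : #|F| = (2 ^ logn 2 #|pPrimeCharType charF2|)%N.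
  exact: card_pprimeChar charF2.
move: odd_F; rewrite cardF oddX orbF => /eqP n0.
by have := finNzRing_gt1 F; rewrite cardF n0.
Qed.

Lemma half_card_finField : #|F| = (#|F|./2).*2.+1.
Proof. by rewrite -[LHS]odd_double_half odd_F. Qed.

Lemma expf_double_half_card (x : F) : x != 0 -> x ^+ (#|F|./2).*2 = 1.
Proof.
by move=> x0; apply/(mulfI x0); rewrite -exprS mulr1 -half_card_finField expf_card.
Qed.

Lemma expf_half_card (x : F) :
  x != 0 -> (x ^+ #|F|./2 == 1) || (x ^+ #|F|./2 == -1).
Proof.
by move=> x0; rewrite -eqf_sqr expr1n -exprM muln2 expf_double_half_card.
Qed.

Lemma finField_N1_neq1 : (-1 : F) != 1.
Proof. by rewrite eq_sym -subr_eq0 opprK -[1 + 1]/(2%:R) finField_two_neq0. Qed.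

Lemma qchar_sqr (x : F) : qchar (x ^+ 2) != -1.
Proof.
rewrite /qchar expf_eq0 /=; have [//|x0] := eqVneq x 0.
by rewrite -exprM mul2n expf_double_half_card // eqxx.
Qed.

Lemma qchar0 : qchar (0 : F) = 0.
Proof. by rewrite /qchar eqxx. Qed.

Lemma qchar1 : qchar (1 : F) = 1.
Proof. by rewrite /qchar oner_eq0 expr1n eqxx. Qed.

Lemma qcharM (x y : F) : qchar (x * y) = qchar x * qchar y.
Proof.
have [->|x0] := eqVneq x 0; first by rewrite mul0r qchar0 mul0r.
have [->|y0] := eqVneq y 0; first by rewrite mulr0 qchar0 mulr0.
rewrite /qchar mulf_eq0 (negPf x0) (negPf y0) /= exprMn.
by have /orP[/eqP-> | /eqP->] := expf_half_card x0;
  have /orP[/eqP-> | /eqP->] := expf_half_card y0;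
  rewrite ?(mulr1, mul1r, mulrNN, eqxx) ?(negPf finField_N1_neq1).
Qed.

Lemma qchar_prod (I : finType) (P : pred I) (t : I -> F) :
  qchar (\prod_(i | P i) t i) = \prod_(i | P i) qchar (t i).
Proof. exact: (big_morph _ qcharM qchar1). Qed.

Lemma normr_qchar (x : F) : `|qchar x| <= 1.
Proof. by rewrite /qchar; case: ifP => // _; case: ifP. Qed.

(** The sum is the number of solutions for [a = 1] minus that for [a = -1]. Those two solution sets
    and the at most [2m + 1] roots partition [F], so the upper bound on each set is also a lower
    bound on the other. The roots cost [(2m + 1) q], as [N <= q], whence [5m + 2] becomes
    [7m + 3]. *)
Lemma qchar_sum_bound (f : {poly F}) (m N : nat) :
  size f = m.*2.+2 -> (N ^ 2 * 2 <= #|F|./2)%N ->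
  (m.*2 + N.*2 <= #|F|./2)%N -> (0 < N)%N ->
  `|\sum_x qchar f.[x]| * N%:Z <= ((7 * m + 3) * #|F|)%:Z.
Proof.
move=> size_f N2h mNh N0; pose h := #|F|./2.
have f0 : f != 0 by rewrite -size_poly_gt0 size_f.
have h_eq : h = (m + (h - m))%N by rewrite subnKC // /h; lia.
have d_gt0 : (0 < h - m)%N by rewrite subn_gt0 /h; lia.
pose A a := [set x | f.[x] ^+ h == a].
have cardA a : a != 0 -> (#|A a| * N.*2 <= (N + 5 * m + 2) * #|F|)%N.
  by move=> a0; apply: (stepanov half_card_finField size_f h_eq d_gt0).
have := cardA 1 (oner_neq0 _); have := cardA (-1); rewrite oppr_eq0 oner_neq0.
move=> /(_ isT); pose Z := [set x | root f x].
have cardZ : (#|Z| <= m.*2.+1)%N.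
  rewrite -ltnS -size_f cardE max_poly_roots ?enum_uniq //.
  by apply/allP => x; rewrite mem_enum inE.
have cardZE (B : {set F}) : #|B|%:Z = \sum_x (x \in B)%:Z.
  by rewrite -sum1_card -natz natr_sum big_mkcond; apply: eq_bigr => x _; case: ifP.
have cases x : qchar f.[x] = (x \in A 1)%:Z - (x \in A (-1))%:Z /\
    1 = (x \in Z)%:Z + (x \in A 1)%:Z + (x \in A (-1))%:Z.
  rewrite !inE rootE /qchar -/h; have [->|fx0] := eqVneq f.[x] 0.
    rewrite expr0n gtn_eqF; last lia.
    by rewrite ![0 == _]eq_sym oppr_eq0 oner_eq0.
  have /orP[/eqP-> | /eqP->] := expf_half_card fx0; rewrite eqxx.
    by rewrite [1 == -1]eq_sym (negPf finField_N1_neq1).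
  by rewrite (negPf finField_N1_neq1).
have -> : \sum_x qchar f.[x] = #|A 1|%:Z - #|A (-1)|%:Z.
  by rewrite !cardZE -sumrB; apply: eq_bigr => x _; have [-> _] := cases x.
have card_part : #|F|%:Z = #|Z|%:Z + #|A 1|%:Z + #|A (-1)|%:Z.
  rewrite !cardZE -!big_split /= -cardsT cardZE; apply: eq_bigr => x _.
  by rewrite inE; have [_ <-] := cases x.
have N_le : (N * (m.*2.+1) <= #|F| * m.*2.+1)%N by rewrite leq_mul2r; lia.
have NZ : (N * #|Z| <= N * m.*2.+1)%N by rewrite leq_mul2l cardZ orbT.
move: card_part NZ N_le; move: #|A 1| #|A (-1)| #|Z| => u v z; nia.
Qed.

End QuadraticCharacter.

(** * Ternary quadratic forms, their duals, and the parametrization of a conic *)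

Record ternary_form (K : Type) := TernaryForm {
  xx : K; yy : K; zz : K; yz : K; xz : K; xy : K }.

Section TernaryForms.

Variable K : fieldType.
Implicit Types (G H : ternary_form K) (u v w e f g p : 'rV[K]_3) (t : K).

Definition tf_eval G v : K :=
  xx G * v 0 0 ^+ 2 + yy G * v 0 1 ^+ 2 + zz G * v 0 2 ^+ 2 +
  yz G * (v 0 1 * v 0 2) + xz G * (v 0 0 * v 0 2) + xy G * (v 0 0 * v 0 1).

Definition tf_polar G u v : K :=
  2 * xx G * (u 0 0 * v 0 0) + 2 * yy G * (u 0 1 * v 0 1) +
  2 * zz G * (u 0 2 * v 0 2) +
  yz G * (u 0 1 * v 0 2 + u 0 2 * v 0 1) +
  xz G * (u 0 0 * v 0 2 + u 0 2 * v 0 0) +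
  xy G * (u 0 0 * v 0 1 + u 0 1 * v 0 0).

(** Half the determinant of the Gram matrix of [tf_polar G]. *)
Definition tf_disc G : K :=
  4 * xx G * yy G * zz G + yz G * xz G * xy G -
  xx G * yz G ^+ 2 - yy G * xz G ^+ 2 - zz G * xy G ^+ 2.

(* The value at [a] is the discriminant of the restriction of [G] to the plane
   orthogonal to [a], with respect to a basis whose cross product is [a]. *)
Definition tf_dual G : ternary_form K := {|
  xx := yz G ^+ 2 - 4 * yy G * zz G;
  yy := xz G ^+ 2 - 4 * xx G * zz G;
  zz := xy G ^+ 2 - 4 * xx G * yy G;
  yz := 2 * (2 * yz G * xx G - xy G * xz G);
  xz := 2 * (2 * xz G * yy G - xy G * yz G);
  xy := 2 * (2 * xy G * zz G - xz G * yz G) |}.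

Lemma tf_disc_dual G : tf_disc (tf_dual G) = - 16 * tf_disc G ^+ 2.
Proof. by rewrite /tf_disc /=; ring. Qed.

Definition vec3 (x y z : K) : 'rV[K]_3 := \row_i [:: x; y; z]`_i.

Definition dot3 u v : K := u 0 0 * v 0 0 + u 0 1 * v 0 1 + u 0 2 * v 0 2.

Definition cross3 u v : 'rV[K]_3 :=
  vec3 (u 0 1 * v 0 2 - u 0 2 * v 0 1)
       (u 0 2 * v 0 0 - u 0 0 * v 0 2)
       (u 0 0 * v 0 1 - u 0 1 * v 0 0).

Definition det3 u v w : K := dot3 (cross3 u v) w.

Definition tf_grad G v : 'rV[K]_3 :=
  vec3 (2 * xx G * v 0 0 + xy G * v 0 1 + xz G * v 0 2)
       (xy G * v 0 0 + 2 * yy G * v 0 1 + yz G * v 0 2)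
       (xz G * v 0 0 + yz G * v 0 1 + 2 * zz G * v 0 2).

Lemma row3P u v :
  u 0 0 = v 0 0 -> u 0 1 = v 0 1 -> u 0 2 = v 0 2 -> u = v.
Proof.
move=> e0 e1 e2; apply/rowP => -[[|[|[|//]]] lt_i].
- by have -> : Ordinal lt_i = 0 by apply: val_inj.
- by have -> : Ordinal lt_i = 1 by apply: val_inj.
- by have -> : Ordinal lt_i = 2 by apply: val_inj.
Qed.

Lemma row3_neq0 v : v != 0 -> [|| v 0 0 != 0, v 0 1 != 0 | v 0 2 != 0].
Proof.
apply: contraNT; rewrite !negb_or !negbK => /and3P[/eqP e0 /eqP e1 /eqP e2].
by apply/eqP/row3P; rewrite mxE.
Qed.

Lemma tf_evalD G u v t :
  tf_eval G (u + t *: v) = tf_eval G u + t * tf_polar G u v + t ^+ 2 * tf_eval G v.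
Proof. by rewrite /tf_eval /tf_polar !mxE; ring. Qed.

Lemma tf_eval_param G e f g t :
  tf_eval G (e + t *: f + t ^+ 2 *: g) =
  tf_eval G e + t * tf_polar G e f + t ^+ 2 * (tf_eval G f + tf_polar G e g) +
  t ^+ 3 * tf_polar G f g + t ^+ 4 * tf_eval G g.
Proof. by rewrite /tf_eval /tf_polar !mxE; ring. Qed.

Lemma tf_eval_comb G e f g (a b c : K) :
  tf_eval G (a *: e + b *: f + c *: g) =
  a ^+ 2 * tf_eval G e + b ^+ 2 * tf_eval G f + c ^+ 2 * tf_eval G g +
  a * b * tf_polar G e f + a * c * tf_polar G e g + b * c * tf_polar G f g.
Proof. by rewrite /tf_eval /tf_polar !mxE; ring. Qed.

Lemma tf_evalZ G c v : tf_eval G (c *: v) = c ^+ 2 * tf_eval G v.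
Proof. by rewrite /tf_eval !mxE; ring. Qed.

Lemma cramer3 e f g v :
  det3 e f g *: v =
  det3 v f g *: e + det3 e v g *: f + det3 e f v *: g.
Proof. by apply: row3P; rewrite /det3 /dot3 !mxE /=; ring. Qed.

Lemma tf_dual_cross G v w :
  tf_eval (tf_dual G) (cross3 v w) =
  tf_polar G v w ^+ 2 - 4 * tf_eval G v * tf_eval G w.
Proof. by rewrite /tf_eval /tf_polar !mxE /=; ring. Qed.

(** A vector orthogonal to [v] is a cross product of [v] with some [w], and in [tf_dual_cross] only
    the square of the polar form survives when [G] vanishes at [v]. *)
Lemma tf_dual_sqr G (a v : 'rV[K]_3) :
  v != 0 -> tf_eval G v = 0 -> dot3 a v = 0 ->
  exists y, tf_eval (tf_dual G) a = y ^+ 2.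
Proof.
move=> v0 Gv av; suff [w ->] : exists w, a = cross3 v w.
  by exists (tf_polar G v w); rewrite tf_dual_cross Gv; ring.
have perp : a 0 0 * v 0 0 + a 0 1 * v 0 1 + a 0 2 * v 0 2 = 0 by [].
have /or3P[vi|vi|vi] := row3_neq0 v0.
- have e : a 0 0 = - (a 0 1 * v 0 1 + a 0 2 * v 0 2) / v 0 0.
    by apply/(mulIf vi); rewrite divfK //; apply/eqP; rewrite -addr_eq0 addrA perp.
  exists (vec3 0 (a 0 2 / v 0 0) (- a 0 1 / v 0 0)).
  by apply: row3P; rewrite !mxE /= ?e; field.
- have e : a 0 1 = - (a 0 0 * v 0 0 + a 0 2 * v 0 2) / v 0 1.
    apply/(mulIf vi); rewrite divfK //; apply/eqP.
    by rewrite -addr_eq0 addrCA addrA perp.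
  exists (vec3 (- a 0 2 / v 0 1) 0 (a 0 0 / v 0 1)).
  by apply: row3P; rewrite !mxE /= ?e; field.
- have e : a 0 2 = - (a 0 0 * v 0 0 + a 0 1 * v 0 1) / v 0 2.
    by apply/(mulIf vi); rewrite divfK //; apply/eqP; rewrite -addr_eq0 addrC perp.
  exists (vec3 (a 0 1 / v 0 2) (- a 0 0 / v 0 2) 0).
  by apply: row3P; rewrite !mxE /= ?e; field.
Qed.

Lemma tf_polar_grad G u v : tf_polar G u v = dot3 u (tf_grad G v).
Proof. by rewrite /tf_polar /dot3 !mxE /=; ring. Qed.

Lemma tf_polarC G u v : tf_polar G u v = tf_polar G v u.
Proof. by rewrite /tf_polar; ring. Qed.

Lemma tf_polarDr G u v w t :
  tf_polar G u (v + t *: w) = tf_polar G u v + t * tf_polar G u w.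
Proof. by rewrite /tf_polar !mxE; ring. Qed.

Lemma tf_polarDl G u v w t :
  tf_polar G (u + t *: w) v = tf_polar G u v + t * tf_polar G w v.
Proof. by rewrite /tf_polar !mxE; ring. Qed.

Lemma tf_polarZr G u v t : tf_polar G u (t *: v) = t * tf_polar G u v.
Proof. by rewrite /tf_polar !mxE; ring. Qed.

Lemma tf_polar_diag G v : tf_polar G v v = 2 * tf_eval G v.
Proof. by rewrite /tf_polar /tf_eval; ring. Qed.

(** The adjugate of the Gram matrix sends the gradient to [2 * tf_disc G] times [v]; the three
    identities are its rows. *)
Lemma tf_grad_eq0 G v : (2 : K) != 0 -> tf_disc G != 0 -> tf_grad G v = 0 -> v = 0.
Proof.
move=> two0 disc0 grad0; have n i : tf_grad G v 0 i = 0 by rewrite grad0 mxE.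
have disc2 : 2 * tf_disc G != 0 by rewrite mulf_neq0.
apply: row3P; rewrite [RHS]mxE; apply/(mulfI disc2); rewrite mulr0.
- have -> : 2 * tf_disc G * v 0 0 = (4 * yy G * zz G - yz G ^+ 2) * tf_grad G v 0 0 +
      (xz G * yz G - 2 * xy G * zz G) * tf_grad G v 0 1 +
      (xy G * yz G - 2 * xz G * yy G) * tf_grad G v 0 2 by rewrite !mxE /tf_disc /=; ring.
  by rewrite !n !mulr0 !addr0.
- have -> : 2 * tf_disc G * v 0 1 = (xz G * yz G - 2 * xy G * zz G) * tf_grad G v 0 0 +
      (4 * xx G * zz G - xz G ^+ 2) * tf_grad G v 0 1 +
      (xz G * xy G - 2 * yz G * xx G) * tf_grad G v 0 2 by rewrite !mxE /tf_disc /=; ring.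
  by rewrite !n !mulr0 !addr0.
- have -> : 2 * tf_disc G * v 0 2 = (xy G * yz G - 2 * xz G * yy G) * tf_grad G v 0 0 +
      (xz G * xy G - 2 * yz G * xx G) * tf_grad G v 0 1 +
      (4 * xx G * yy G - xy G ^+ 2) * tf_grad G v 0 2 by rewrite !mxE /tf_disc /=; ring.
  by rewrite !n !mulr0 !addr0.
Qed.

Lemma tf_eval_cross_grad G e p :
  tf_eval G (cross3 (tf_grad G e) (tf_grad G p)) =
  tf_disc G * (4 * tf_eval G e * tf_eval G p - tf_polar G e p ^+ 2).
Proof. by rewrite /tf_eval /tf_polar /tf_disc !mxE /=; ring. Qed.

Lemma det3_cross_grad G e p :
  det3 e (cross3 (tf_grad G e) (tf_grad G p)) p =
  tf_polar G e p ^+ 2 - 4 * tf_eval G e * tf_eval G p.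
Proof. by rewrite /det3 /dot3 /tf_eval /tf_polar !mxE /=; ring. Qed.

Lemma dot3_crossl u v : dot3 (cross3 u v) u = 0.
Proof. by rewrite /dot3 !mxE /=; ring. Qed.

Lemma dot3_crossr u v : dot3 (cross3 u v) v = 0.
Proof. by rewrite /dot3 !mxE /=; ring. Qed.

Lemma dot3Zr u v t : dot3 u (t *: v) = t * dot3 u v.
Proof. by rewrite /dot3 !mxE; ring. Qed.

(* In coordinates [alpha, beta, gamma] on the basis [e, f, g], a form vanishing
   on the parametrized conic is a multiple of [beta^2 - alpha gamma]. *)
Lemma conic_param G p :
  (2 : K) != 0 -> tf_disc G != 0 -> p != 0 -> tf_eval G p = 0 ->
  exists e f g, [/\ forall t, tf_eval G (e + t *: f + t ^+ 2 *: g) = 0,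
    forall t, tf_polar G g (e + t *: f + t ^+ 2 *: g) != 0 &
    forall H, [/\ tf_eval H e = 0, tf_polar H e f = 0,
        tf_eval H f + tf_polar H e g = 0, tf_polar H f g = 0 & tf_eval H g = 0] ->
      exists c, forall v, tf_eval H v = c * tf_eval G v].
Proof.
move=> two0 disc0 p0 Gp.
have [u beta0] : exists u, tf_polar G u p != 0.
  have /row3_neq0 : tf_grad G p != 0.
    by apply: contra p0 => /eqP /(tf_grad_eq0 two0 disc0) ->.
  case/or3P => n0; [exists (vec3 1 0 0)|exists (vec3 0 1 0)|exists (vec3 0 0 1)];
    apply: contra n0; rewrite tf_polar_grad /dot3 !mxE /=;
    by rewrite ?(mul1r, mul0r, add0r, addr0).
set beta := tf_polar G u p in beta0.
(* [e] is the second point of the conic on the line through [u] and [p]; [f] below is conjugate to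
   both [e] and [p]. *)
pose e := u + (- (tf_eval G u / beta)) *: p.
have Ge : tf_eval G e = 0 by rewrite tf_evalD Gp -/beta mulNr divfK // subrr mulr0 addr0.
have Bep : tf_polar G e p = beta.
  by rewrite tf_polarDl tf_polar_diag Gp -/beta !mulr0 addr0.
pose f := cross3 (tf_grad G e) (tf_grad G p).
have Gf : tf_eval G f = - tf_disc G * beta ^+ 2.
  by rewrite tf_eval_cross_grad Ge Gp Bep; ring.
have Gf0 : tf_eval G f != 0 by rewrite Gf mulf_neq0 ?oppr_eq0 ?expf_neq0.
have Bef : tf_polar G e f = 0 by rewrite tf_polarC tf_polar_grad dot3_crossl.
have Bfp : tf_polar G f p = 0 by rewrite tf_polar_grad dot3_crossr.
(* This scaling of [p] cancels the coefficient of [t^2] in [tf_eval_param], the other four being 0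
   already. *)
pose c := - (tf_eval G f / beta); pose g := c *: p.
have c0 : c != 0 by rewrite oppr_eq0 mulf_neq0 ?invr_eq0.
have Beg : tf_polar G e g = - tf_eval G f by rewrite tf_polarZr Bep /c; field.
have Bfg : tf_polar G f g = 0 by rewrite tf_polarZr Bfp mulr0.
have Gg : tf_eval G g = 0 by rewrite tf_evalZ Gp mulr0.
have d0 : det3 e f g != 0.
  rewrite /det3 dot3Zr -/(det3 e f p) det3_cross_grad Ge Gp Bep.
  by rewrite mulf_neq0 // mulr0 subr0 expf_neq0.
exists e, f, g; split=> [t|t|H [He Bhef Hf Bhfg Hg]].
- by rewrite tf_eval_param Ge Bef Beg Bfg Gg; ring.
- rewrite 2!tf_polarDr (tf_polarC G g e) (tf_polarC G g f) Beg Bfg tf_polar_diag Gg.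
  by rewrite !mulr0 !addr0 oppr_eq0.
have d20 : det3 e f g ^+ 2 != 0 by rewrite expf_neq0.
exists (tf_eval H f / tf_eval G f) => v; apply/(mulfI d20).
have Bheg : tf_polar H e g = - tf_eval H f by apply/eqP; rewrite -addr_eq0 addrC Hf.
rewrite mulrCA -!tf_evalZ cramer3 !tf_eval_comb.
by rewrite Ge Bef Beg Bfg Gg He Bhef Bheg Bhfg Hg; field.
Qed.

Lemma tf_eval_inj G H : (forall v, tf_eval G v = tf_eval H v) -> G = H.
Proof.
move=> eqGH.
have := eqGH (vec3 1 0 0); have := eqGH (vec3 0 1 0); have := eqGH (vec3 0 0 1).
have := eqGH (vec3 0 1 1); have := eqGH (vec3 1 0 1); have := eqGH (vec3 1 1 0).
rewrite /tf_eval !mxE /= !(expr0n, expr1n, mulr0, mulr1, addr0, add0r) /=.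
case: G {eqGH} => G1 G2 G3 G4 G5 G6; case: H => H1 H2 H3 H4 H5 H6 /=.
by move=> e6 e5 e4 e3 e2 e1; subst; move: e6 e5 e4 => /addrI -> /addrI -> /addrI ->.
Qed.

Lemma tf_disc_scale G H c : (forall v, tf_eval H v = c * tf_eval G v) ->
  tf_disc H = c ^+ 3 * tf_disc G.
Proof.
move=> eqHG; pose G' := TernaryForm (c * xx G) (c * yy G) (c * zz G)
  (c * yz G) (c * xz G) (c * xy G).
have -> : H = G'.
  by apply: tf_eval_inj => v; rewrite eqHG /tf_eval /=; ring.
by rewrite /tf_disc /=; ring.
Qed.

End TernaryForms.

(** * Character sums over [F^3] along parallel lines *)

Lemma card_setZ (T : finType) (P : pred T) : #|[set x | P x]|%:Z = \sum_x (P x)%:Z.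
Proof.
rewrite -sum1_card -natz natr_sum big_mkcond; apply: eq_bigr => x _.
by rewrite inE; case: ifP.
Qed.

Section Directions.

Variable F : finFieldType.
Hypothesis odd_F : odd #|F|.
Local Notation q := #|F|.
Implicit Types (u v w P : 'rV[F]_3).

(** For fixed [t] the translation by [t *: P] permutes [F^3]. Summing over all base points avoids
    choosing representatives of the parallel lines. *)
Lemma sum_directions (s : 'rV[F]_3 -> int) P :
  \sum_u \sum_(t : F) s (u + t *: P) = q%:Z * \sum_u s u.
Proof.
rewrite exchange_big /=.
under eq_bigr => t _ do rewrite -(reindex_inj (addIr (t *: P)) (P := predT) (F := s)).
by rewrite sumr_const -mulr_natl natz.
Qed.

Lemma card_directions (Z : pred 'rV[F]_3) P n :
  (forall u, (#|[set t : F | Z (u + t *: P)%R]| <= n)%N) ->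
  (#|[set u | Z u]| <= n * q ^ 2)%N.
Proof.
move=> Zn; have q0 : (0 < q)%N by rewrite (cardD1 0) inE.
have : q%:Z * #|[set u | Z u]|%:Z <= \sum_(u : 'rV[F]_3) n%:Z.
  rewrite card_setZ -(sum_directions (fun u => (Z u)%:Z) P).
  by apply: ler_sum => u _; rewrite -card_setZ lez_nat.
rewrite sumr_const card_mx mul1n -mulr_natr natz -!PoszM lez_nat.
by rewrite expnS mulnCA leq_pmul2l.
Qed.

Section Family.

Variables (J : finType) (D : J -> ternary_form F) (S : {set J}).
Hypothesis disc_D : forall j, j \in S -> tf_disc (D j) != 0.
Hypothesis isotropic_D :
  forall j, j \in S -> exists2 p, p != 0 & tf_eval (D j) p = 0.
Hypothesis independent_D : forall i j, i \in S -> j \in S -> i != j ->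
  ~ exists c, forall v, tf_eval (D j) v = c * tf_eval (D i) v.

(** On the parametrized conic of [D i] every other form becomes a polynomial of degree at most 4 in
    [t], nonzero because the forms are not proportional. Their product has fewer than [q] roots, and
    any non-root gives [P]. The vector [w] shows that the polar form against [P] is not identically
    0. *)
Lemma exists_direction i : i \in S -> (#|S| * 4 < q)%N ->
  exists P w, [/\ tf_eval (D i) P = 0, tf_polar (D i) w P != 0 &
    forall j, j \in S -> j != i -> tf_eval (D j) P != 0].
Proof.
move=> iS Sq; have [p p0 Dp] := isotropic_D iS.
have [e [f [g [De Dg indep]]]] :=
  conic_param (finField_two_neq0 odd_F) (disc_D iS) p0 Dp.
pose r j := Poly [:: tf_eval (D j) e; tf_polar (D j) e f;
  tf_eval (D j) f + tf_polar (D j) e g; tf_polar (D j) f g; tf_eval (D j) g].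
have rE j t : (r j).[t] = tf_eval (D j) (e + t *: f + t ^+ 2 *: g).
  by rewrite horner_Poly /= tf_eval_param; ring.
have r0 j : j \in S -> j != i -> r j != 0.
  move=> jS ji; apply/eqP => rj0; apply: (independent_D iS jS).
    by rewrite eq_sym.
  have c k : (r j)`_k = 0 by rewrite rj0 coef0.
  have := (c 0%N, c 1%N, c 2%N, c 3%N, c 4%N); rewrite !coef_Poly /=.
  by case=> [[[[c0 c1] c2] c3] c4]; apply: indep.
pose R := \prod_(j in S :\ i) r j.
have R0 : R != 0.
  by apply/prodf_neq0 => j; rewrite !inE => /andP[ji jS]; apply: r0.
have size_R : (size R <= #|S| * 4)%N.
  apply: leq_trans (size_poly_prod_leq _ _) _.
  have : (\sum_(j in S :\ i) size (r j) <= #|S :\ i| * 5)%N.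
    rewrite -sum_nat_const; apply: leq_sum => j _; exact: size_Poly.
  set n := (X in (_ - X)%N); have -> : n = #|S :\ i| by apply: eq_card => j.
  by rewrite (cardsD1 i S) iS; lia.
have [t Rt] : exists t, ~~ root R t.
  apply/existsP; apply: contraLR Sq => /existsPn Rt; rewrite -leqNgt.
  apply: leq_trans size_R; rewrite cardE ltnW // max_poly_roots ?enum_uniq //.
  by apply/allP => x _; have := Rt x; rewrite negbK.
exists (e + t *: f + t ^+ 2 *: g), g; split=> // j jS ji.
apply: contra Rt => Dj; rewrite /R (bigD1 j) ?inE ?ji //=.
by rewrite rootM rootE rE Dj.
Qed.

Lemma qchar_prod_sum_bound N : S != finset.set0 ->
  (N ^ 2 * 2 <= q./2)%N -> (#|S|.*2 + N.*2 <= q./2)%N -> (0 < N)%N ->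
  `|\sum_u qchar (\prod_(j in S) tf_eval (D j) u)| * N%:Z
    <= (8 * #|S| * q ^ 3)%:Z.
Proof.
move=> /finset.set0Pn [i iS] N2q Sq N0; have q0 : (0 < q)%N by rewrite (cardD1 0) inE.
have [|P [w [DP wP DjP]]] := exists_direction iS; first lia.
have cardS : #|S| = (#|S :\ i|).+1 by rewrite (cardsD1 i S) iS.
(* From a bad base point [D i] is constant along the line and the odd degree is lost. The trivial
   bound [q] serves there, as at most [q^2] base points are bad. *)
pose bad u := tf_polar (D i) u P == 0.
have card_bad : (#|[set u | bad u]| <= 1 * q ^ 2)%N.
  apply: (@card_directions _ w) => u.
  rewrite -[leqRHS](cards1 (- tf_polar (D i) u P / tf_polar (D i) w P)).
  apply/subset_leq_card/fintype.subsetP => t; rewrite !inE /bad tf_polarDl addrC addr_eq0.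
  by move/eqP <-; rewrite mulfK.
pose s u : int := qchar (\prod_(j in S) tf_eval (D j) u).
have line u : `|\sum_(t : F) s (u + t *: P)| * N%:Z <=
    (7 * #|S| * q)%:Z + (bad u)%:Z * (q * N)%:Z.
  have [bad_u|good_u] := boolP (bad u).
    rewrite mul1r; apply: (@le_trans _ _ (q * N)%:Z); last by rewrite lerDr.
    rewrite PoszM ler_pM2r ?ltz_nat //; apply: le_trans (ler_norm_sum _ _ _) _.
    apply: (@le_trans _ _ (\sum_(t : F) 1)).
      by apply: ler_sum => t _; apply: normr_qchar.
    by rewrite sumr_const natz.
  rewrite mul0r addr0.
  pose r j := Poly [:: tf_eval (D j) u; tf_polar (D j) u P; tf_eval (D j) P].
  have rE j t : (r j).[t] = tf_eval (D j) (u + t *: P).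
    by rewrite horner_Poly /= tf_evalD; ring.
  have size_r j : j \in S -> size (r j) = if j == i then 2%N else 3%N.
    move=> jS; case: eqP => [->|/eqP ji]; last by rewrite /r (PolyK (c := 0)) //= DjP.
    rewrite /r DP (_ : Poly _ = Poly [:: tf_eval (D i) u; tf_polar (D i) u P]).
      by rewrite (PolyK (c := 0)).
    by apply/polyP => -[|[|[|k]]]; rewrite !coef_Poly /= ?nth_nil.
  pose R := \prod_(j in S) r j.
  have size_R : size R = (#|S :\ i|).*2.+2.
    rewrite size_prod => [|j jS]; last by rewrite -size_poly_gt0 size_r //; case: ifP.
    rewrite (bigD1 i) //= size_r // eqxx.
    rewrite (eq_bigr (fun=> 3%N)) => [|j /andP[jS ji]]; last first.
      by rewrite size_r // (negPf ji).
    rewrite sum_nat_const (_ : #|_| = #|S :\ i|); last first.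
      by apply: eq_card => j; rewrite !inE andbC.
    set n := (X in (_ - X)%N); have -> : n = #|S| by apply: eq_card => j.
    by rewrite cardS; lia.
  have -> : \sum_(t : F) s (u + t *: P) = \sum_t qchar R.[t].
    apply: eq_bigr => t _; rewrite /s horner_prod; congr qchar.
    by apply: eq_bigr => j _; rewrite rE.
  apply: le_trans (qchar_sum_bound odd_F size_R N2q _ N0) _; first lia.
  by rewrite lez_nat cardS leq_mul2r; lia.
have : q%:Z * (`|\sum_u s u| * N%:Z) <= q%:Z * (8 * #|S| * q ^ 3)%:Z.
  rewrite mulrA -[q%:Z * `|_|](_ : `|q%:Z * \sum_u s u| = _); last first.
    by rewrite normrM.
  rewrite -(sum_directions s P).
  apply: le_trans (ler_wpM2r _ (ler_norm_sum _ _ _)) _ => //.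
  rewrite mulr_suml; apply: le_trans (ler_sum _ (fun u _ => line u)) _.
  rewrite big_split /= -mulr_suml -card_setZ sumr_const card_mx mul1n.
  rewrite -mulr_natr natz -!PoszM -PoszD lez_nat.
  apply: (@leq_trans (7 * #|S| * q * q ^ 3 + 1 * q ^ 2 * (q * N))).
    by rewrite leq_add2l leq_mul2r card_bad orbT.
  (* As [N <= q], the bad base points raise the constant from 7 to 8. *)
  have : (q ^ 3 * N <= q ^ 3 * (q * #|S|))%N.
    by rewrite leq_mul2l; nia.
  move: #|S| #|F| => k r; rewrite !expnS expn0 !muln1; nia.
by rewrite ler_pM2l // ltz_nat.
Qed.

End Family.

End Directions.

(** * Nonsquare values taken simultaneously by several forms *)

Section SimultaneousNonsquares.

Variable F : finFieldType.
Hypothesis odd_F : odd #|F|.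
Local Notation q := #|F|.

Lemma card_tf_zeros (G : ternary_form F) : tf_disc G != 0 ->
  (#|[set u | tf_eval G u == 0%R]| <= 2 * q ^ 2)%N.
Proof.
move=> disc0; have [P GP] : exists P, tf_eval G P != 0.
  apply/existsP; apply: contraNT disc0 => /existsPn G0.
  rewrite (_ : G = TernaryForm 0 0 0 0 0 0) /tf_disc /=; first by apply/eqP; ring.
  apply: tf_eval_inj => v; have := G0 v; rewrite negbK => /eqP ->.
  by rewrite /tf_eval /=; ring.
apply: (@card_directions _ _ P) => u.
pose r := Poly [:: tf_eval G u; tf_polar G u P; tf_eval G P].
have size_r : size r = 3%N by rewrite (PolyK (c := 0)).
have r0 : r != 0 by rewrite -size_poly_gt0 size_r.
rewrite -ltnS -[leqRHS]size_r cardE max_poly_roots ?enum_uniq //.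
apply/allP => t; rewrite mem_enum inE tf_evalD => /eqP Gt.
by rewrite rootE horner_Poly /= -[X in _ == X]Gt; apply/eqP; ring.
Qed.

Variables (J : finType) (D : J -> ternary_form F).
Hypothesis disc_D : forall j, tf_disc (D j) != 0.
Hypothesis isotropic_D : forall j, exists2 p, p != 0 & tf_eval (D j) p = 0.
Hypothesis independent_D : forall i j, i != j ->
  ~ exists c, forall v, tf_eval (D j) v = c * tf_eval (D i) v.

Lemma simultaneous_nonsquares N :
  (N ^ 2 * 2 <= q./2)%N -> (#|J|.*2 + N.*2 <= q./2)%N -> (0 < N)%N ->
  (2 ^ #|J| * (8 * #|J| * q + 2 * #|J| * N) < N * q)%N ->
  exists u, forall j, qchar (tf_eval (D j) u) = -1.
Proof.
move=> N2q Jq N0 ltNq.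
suff /existsP [u /forallP u_good] :
    [exists u : 'rV[F]_3, [forall j, qchar (tf_eval (D j) u) == -1]].
  by exists u => j; apply/eqP.
apply: contraLR ltNq => /existsPn no_good; rewrite -leqNgt.
have q0 : (0 < q)%N by rewrite (cardD1 0) inE.
pose chi j (u : 'rV[F]_3) := qchar (tf_eval (D j) u).
pose Z := [set u : 'rV[F]_3 | [exists j, tf_eval (D j) u == 0]].
have cardZ : (#|Z| <= #|J| * (2 * q ^ 2))%N.
  rewrite -lez_nat; apply: (@le_trans _ _ (\sum_j (2 * q ^ 2)%:Z)); last first.
    by rewrite sumr_const -mulr_natl natz -PoszM; apply: lexx.
  rewrite card_setZ.
  apply: (@le_trans _ _ (\sum_j #|[set u | tf_eval (D j) u == 0]|%:Z)).
    under [leRHS]eq_bigr do rewrite card_setZ.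
    rewrite exchange_big /=; apply: ler_sum => u _.
    have [[j Dj]|no_zero] := altP existsP; last exact: sumr_ge0.
    by rewrite (bigD1 j) //= Dj lerDl sumr_ge0.
  by apply: ler_sum => j _; rewrite lez_nat card_tf_zeros.
(* Off [Z], the assumed failure of [u] gives some [j] with [chi j u = 1], which kills the product;
   on [Z] each factor is at most 2. *)
have upper : \sum_u \prod_j (1 - chi j u) <= (#|Z| * 2 ^ #|J|)%:Z.
  rewrite PoszM card_setZ mulr_suml; apply: ler_sum => u _.
  have [[j Dj]|no_zero] := altP existsP.
    rewrite mul1r -[(2 ^ _)%N]prod_nat_const -[X in _ <= X]natz natr_prod.
    apply: ler_prod => i _; rewrite /chi.
    by have := normr_qchar (tf_eval (D i) u); rewrite ler_norml; lia.
  rewrite mul0r; have /forallPn [j chi_j] := no_good u.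
  rewrite (bigD1 j) //= /chi; move/existsPn/(_ j): no_zero => Dj.
  move: chi_j; rewrite /qchar (negPf Dj); case: ifP => // _ _.
  by rewrite subrr mul0r.
have lower : (q ^ 3)%:Z * N%:Z - (2 ^ #|J| * (8 * #|J| * q ^ 3))%:Z <=
    (\sum_u \prod_j (1 - chi j u)) * N%:Z.
  have -> : \sum_u \prod_j (1 - chi j u) =
      \sum_(T : {set J}) (-1) ^+ #|T| * \sum_u qchar (\prod_(j in T) tf_eval (D j) u).
    have distr (c : J -> int) :
        \prod_j (c j + 1) = \sum_(T : {set J}) \prod_(j in T) c j.
      by under [RHS]eq_bigr do rewrite big_mkcond /=; exact: bigA_distr.
    under eq_bigr => u _ do under eq_bigr => j _ do rewrite addrC.
    under eq_bigr => u _ do rewrite distr.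
    rewrite exchange_big /=; apply: eq_bigr => T _; rewrite mulr_sumr.
    by apply: eq_bigr => u _; rewrite qchar_prod // -prodrN.
  rewrite (bigD1 finset.set0) //= cards0 expr0 mul1r mulrDl.
  have -> : \sum_(u : 'rV[F]_3) qchar (\prod_(j in finset.set0) tf_eval (D j) u) =
      (q ^ 3)%:Z.
    under eq_bigr => u _ do rewrite big_set0 qchar1.
    by rewrite sumr_const card_mx mul1n natz.
  rewrite lerD2l lerNl -mulNr; apply: le_trans (ler_norm _) _.
  rewrite normrM normrN [`|N%:Z|]ger0_norm //.
  apply: le_trans (ler_wpM2r _ (ler_norm_sum _ _ _)) _ => //; rewrite mulr_suml.
  apply: (@le_trans _ _ (\sum_(T : {set J} | T != finset.set0) (8 * #|J| * q ^ 3)%:Z)).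
    apply: ler_sum => T T0; rewrite normrM normrX normrN normr1 expr1n mul1r.
    apply: le_trans (qchar_prod_sum_bound odd_F _ _ _ T0 N2q _ N0) _ => //.
    - by move=> i j _ _; apply: independent_D.
    - by have cardT : (#|T| <= #|J|)%N := max_card _; lia.
    by rewrite lez_nat !leq_mul // max_card.
  rewrite sumr_const -mulr_natr natz -PoszM lez_nat mulnC leq_mul2r.
  by apply/orP; right; rewrite -[#|J|]cardsT -card_powerset powersetT cardsT max_card.
have N_ge0 : 0 <= N%:Z by [].
have := le_trans lower (ler_wpM2r N_ge0 upper).
rewrite lerBlDr -!PoszM -PoszD lez_nat => main.
have : (q ^ 2 * (N * q) <= q ^ 2 * (2 ^ #|J| * (8 * #|J| * q + 2 * #|J| * N)))%N.
  have := leq_mul (leq_mul cardZ (leqnn (2 ^ #|J|)%N)) (leqnn N).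
  rewrite -(leq_add2r (2 ^ #|J| * (8 * #|J| * q ^ 3))) => /(leq_trans main).
  move: (2 ^ #|J|)%N #|J| #|F| => x k r; rewrite !expnS expn0 !muln1; nia.
by rewrite leq_pmul2l // expn_gt0 q0.
Qed.

End SimultaneousNonsquares.

(** The gradient at a point of the conic is its tangent line there, hence a zero of the dual form.
    So a rational point on the conic makes the dual form isotropic. *)
Lemma tf_dual_grad (K : fieldType) (G : ternary_form K) v :
  tf_eval (tf_dual G) (tf_grad G v) = - 4 * tf_disc G * tf_eval G v.
Proof. by rewrite /tf_eval /tf_disc !mxE /=; ring. Qed.

(* The saving of order [q^(1/2)] is used only through [2 ^ (7 * l)], a lower
   bound for [q^(1/2)] that still dominates [4 ^ l]. *)
Lemma nonsquare_arith k l q : (0 < l)%N -> (k <= l)%N -> (2 ^ (20 * l) < q)%N ->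
  [/\ ((2 ^ (7 * l)) ^ 2 * 2 <= q./2)%N, (k.*2 + (2 ^ (7 * l)).*2 <= q./2)%N &
      (2 ^ k * (8 * k * q + 2 * k * 2 ^ (7 * l)) < 2 ^ (7 * l) * q)%N].
Proof.
move=> l0 kl Kq; set N := (2 ^ (7 * l))%N; set A := (2 ^ (2 * l))%N.
have lA2 : (l < 2 ^ l)%N by apply: ltn_expl.
have kA : (2 ^ k * k <= A)%N.
  rewrite /A mul2n -addnn expnD leq_mul ?leq_pexp2l //.
  by rewrite (leq_trans kl) // ltnW.
(* The exponents split as [7 = 5 + 2] and [20 = 14 + 6], giving [32 A <= N] and [64 N^2 <= q], where
   [A = 4^l] bounds [2^k k]. *)
have NA : N = (2 ^ (5 * l) * A)%N by rewrite -expnD; congr (2 ^ _)%N; lia.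
have l32 : (2 ^ 5 <= 2 ^ (5 * l))%N by rewrite leq_pexp2l //; lia.
have l64 : (2 ^ 6 <= 2 ^ (6 * l))%N by rewrite leq_pexp2l //; lia.
have NK : (2 ^ (20 * l) = N ^ 2 * 2 ^ (6 * l))%N.
  by rewrite -expnM -expnD; congr (2 ^ _)%N; lia.
have A0 : (0 < A)%N by rewrite expn_gt0.
have N0 : (0 < N)%N by rewrite expn_gt0.
have N2 : (N <= N ^ 2)%N by rewrite -mulnn leq_pmulr.
have q64 : (N ^ 2 * 64 <= q)%N.
  by apply: ltnW; apply: leq_ltn_trans Kq; rewrite NK leq_mul2l l64 orbT.
have AN : (32 * A <= N)%N by rewrite NA leq_mul2r l32 orbT.
have lA : (2 ^ l <= A)%N by rewrite leq_pexp2l //; lia.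
clearbody N A.
split; try lia.
rewrite (_ : 2 ^ k * _ = (2 ^ k * k) * (8 * q + 2 * N))%N; last by ring.
apply: leq_ltn_trans (leq_mul kA (leqnn _)) _.
have := leq_mul AN (leqnn q); have := leq_mul AN (leqnn N).
have : (0 < N * q)%N by rewrite muln_gt0; lia.
have : (A * N <= A * q)%N by rewrite leq_mul2l; lia.
nia.
Qed.

(** Conics without rational points impose nothing and are set aside. Among the others, one index is
    kept for each function [qchar] of the dual form, namely the least: proportional duals define the
    same function, so the kept duals are pairwise non proportional, and a vector good for them is
    good for all. *)
Lemma nonsquare_line (F : finFieldType) (l : nat) (G : 'I_l -> ternary_form F) :
  odd #|F| -> (forall i, tf_disc (G i) != 0) ->
  (0 < l)%N -> (2 ^ (20 * l) < #|F|)%N ->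
  exists2 u, u != 0 & forall i v, v != 0 -> tf_eval (G i) v = 0 ->
    qchar (tf_eval (tf_dual (G i)) u) = -1.
Proof.
move=> odd_F disc0 l0 Kq; have two0 := finField_two_neq0 odd_F.
have n16 : (- 16 : F) != 0.
  by rewrite oppr_eq0 (_ : 16 = 2 ^+ 4) ?expf_neq0 //; ring.
pose D i := tf_dual (G i).
pose pts i := [exists v, (v != 0) && (tf_eval (G i) v == 0)].
pose eqv i j := [forall u, qchar (tf_eval (D i) u) == qchar (tf_eval (D j) u)].
pose least (i : 'I_l) :=
  pts i && [forall j : 'I_l, (j < i)%N && pts j ==> ~~ eqv j i].
pose J := {i : 'I_l | least i}.
have cardJ : (#|{: J}| <= l)%N.
  by rewrite card_sig -[X in (_ <= X)%N]card_ord max_card.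
have [Nq1 Nq2 Nq3] := nonsquare_arith l0 cardJ Kq.
have discD i : tf_disc (D i) != 0 by rewrite tf_disc_dual mulf_neq0 ?expf_neq0.
have isoD (j : J) : exists2 p, p != 0 & tf_eval (D (val j)) p = 0.
  have /andP [/existsP [v /andP [v0 /eqP Gv]] _] := valP j.
  exists (tf_grad (G (val j)) v); last by rewrite tf_dual_grad Gv mulr0.
  by apply: contra v0 => /eqP /(tf_grad_eq0 two0 (disc0 _)) ->.
have eqv_of i j c : (forall v, tf_eval (D j) v = c * tf_eval (D i) v) ->
    eqv i j /\ eqv j i.
  move=> eqD; have := tf_disc_scale eqD; rewrite !tf_disc_dual => eq_disc.
  have c0 : c != 0.
    apply: contraNneq (discD j) => c0; rewrite tf_disc_dual eq_disc c0.
    by rewrite expr0n mul0r.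
  (* Proportional dual forms have a square ratio: their discriminants are -16
     times a square and differ by the factor [c^3]. *)
  pose y := tf_disc (G j) / (c * tf_disc (G i)).
  have c_sqr : c = y ^+ 2.
    have : tf_disc (G j) ^+ 2 = c ^+ 3 * tf_disc (G i) ^+ 2.
      by apply/(mulfI n16); rewrite eq_disc; ring.
    rewrite /y expr_div_n => ->; field.
    by rewrite c0 disc0.
  have qc : qchar c = 1.
    have y0 : y != 0 by apply: contraNneq c0 => y0; rewrite c_sqr y0 expr0n.
    rewrite c_sqr expr2 qcharM // /qchar (negPf y0).
    by case: ifP => _; rewrite ?mulr1 ?mulrNN ?mulr1.
  by split; apply/forallP => u; rewrite eqD qcharM // qc mul1r.
have indD (i j : J) : i != j ->
    ~ exists c, forall v, tf_eval (D (val j)) v = c * tf_eval (D (val i)) v.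
  move=> ij [c /eqv_of [eij eji]].
  have /andP [ptsi /forallP /(_ (val j))] := valP i.
  have /andP [ptsj /forallP /(_ (val i))] := valP j.
  rewrite ptsi ptsj eij eji !andbT !implybF -!leqNgt => le1 le2.
  by case/eqP: ij; apply/val_inj/val_inj/eqP; rewrite eqn_leq le1 le2.
have N0 : (0 < 2 ^ (7 * l))%N by rewrite expn_gt0.
have [u uJ] := simultaneous_nonsquares odd_F (fun j : J => discD (val j)) isoD indD
  Nq1 Nq2 N0 Nq3.
have uD i : pts i -> qchar (tf_eval (D i) u) = -1.
  move=> ptsi; have i_ok : pts i && eqv i i.
    by rewrite ptsi; apply/forallP => v.
  have [j /andP [ptsj eqvj] j_min] :=
    @arg_minnP _ i (fun j => pts j && eqv j i) (@nat_of_ord l) i_ok.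
  have least_j : least j.
    rewrite /least ptsj; apply/forallP => k; apply/implyP => /andP [kj ptsk].
    apply: contraL kj => eqvk; rewrite -leqNgt j_min // ptsk.
    by apply/forallP => v; rewrite (eqP (forallP eqvk v)) (forallP eqvj).
  by rewrite -(eqP (forallP eqvj u)); apply: (uJ (Sub j least_j)).
(* One value -1 already forces [u] to be nonzero; if no conic has a rational point, any nonzero
   vector will do. *)
have [/existsP [i ptsi]|no_pts] := boolP [exists i, pts i].
  exists u => [|j v v0 /eqP Gv]; last by apply: uD; apply/existsP; exists v; rewrite v0.
  apply: contra_eq_neq (uD i ptsi) => ->.
  by rewrite -[0](scale0r 0) tf_evalZ expr0n mul0r qchar0.
exists (vec3 1 0 0) => [|j v v0 /eqP Gv].
  by apply/eqP => /rowP /(_ 0); rewrite !mxE /= => /eqP; rewrite oner_eq0.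
by case/existsP: no_pts; exists j; apply/existsP; exists v; rewrite v0.
Qed.

(** * Linear and quadratic forms as multivariate polynomials *)

Section FormPolynomials.

Variable K : fieldType.
Implicit Types (G : ternary_form K) (p : {mpoly K[3]}) (u v : 'rV[K]_3).

Definition linear_mpoly u : {mpoly K[3]} := \sum_i u 0 i *: 'X_i.

Definition quadric_mpoly G : {mpoly K[3]} :=
  xx G *: ('X_0 * 'X_0) + yy G *: ('X_1 * 'X_1) + zz G *: ('X_2 * 'X_2) +
  yz G *: ('X_1 * 'X_2) + xz G *: ('X_0 * 'X_2) + xy G *: ('X_0 * 'X_1).

Definition form_of_mpoly p : ternary_form K := {|
  xx := p@_(U_(0) + U_(0)); yy := p@_(U_(1) + U_(1)); zz := p@_(U_(2) + U_(2));
  yz := p@_(U_(1) + U_(2)); xz := p@_(U_(0) + U_(2)); xy := p@_(U_(0) + U_(1)) |}.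

Lemma mnm3_eq (m m' : 'X_{1..3}) :
  (m == m') = [&& m 0 == m' 0, m 1 == m' 1 & m 2 == m' 2].
Proof.
apply/eqP/and3P => [->|[/eqP e0 /eqP e1 /eqP e2]]; first by rewrite !eqxx.
apply/mnmP => -[[|[|[|//]]] lt_i].
- by have -> : Ordinal lt_i = 0 by apply: val_inj.
- by have -> : Ordinal lt_i = 1 by apply: val_inj.
- by have -> : Ordinal lt_i = 2 by apply: val_inj.
Qed.

Lemma sum3E (V : nmodType) (s : 'I_3 -> V) : \sum_i s i = s 0 + s 1 + s 2.
Proof.
rewrite !big_ord_recr big_ord0 /= add0r; congr (s _ + s _ + s _); exact: val_inj.
Qed.

Lemma linear_mpolyE u : linear_mpoly u = u 0 0 *: 'X_0 + u 0 1 *: 'X_1 + u 0 2 *: 'X_2.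
Proof. exact: sum3E. Qed.

(** Comparison of coefficients at the monomial with exponents [n0], [n1], [n2]: six triples have sum
    2, and all others, including those with an exponent above 2, fall under the last premise. *)
Fact degree2_cases (n0 n1 n2 : nat) (c c00 c11 c22 c12 c02 c01 : K) :
  ([&& 2 == n0, 0 == n1 & 0 == n2]%N -> c = c00) ->
  ([&& 0 == n0, 2 == n1 & 0 == n2]%N -> c = c11) ->
  ([&& 0 == n0, 0 == n1 & 2 == n2]%N -> c = c22) ->
  ([&& 0 == n0, 1 == n1 & 1 == n2]%N -> c = c12) ->
  ([&& 1 == n0, 0 == n1 & 1 == n2]%N -> c = c02) ->
  ([&& 1 == n0, 1 == n1 & 0 == n2]%N -> c = c01) ->
  ((n0 + n1 + n2)%N != 2 -> c = 0) ->
  c = c00 * [&& 2 == n0, 0 == n1 & 0 == n2]%N%:R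
    + c11 * [&& 0 == n0, 2 == n1 & 0 == n2]%N%:R
    + c22 * [&& 0 == n0, 0 == n1 & 2 == n2]%N%:R
    + c12 * [&& 0 == n0, 1 == n1 & 1 == n2]%N%:R
    + c02 * [&& 1 == n0, 0 == n1 & 1 == n2]%N%:R
    + c01 * [&& 1 == n0, 1 == n1 & 0 == n2]%N%:R.
Proof.
case: n0 => [|[|[|n0]]]; case: n1 => [|[|[|n1]]]; case: n2 => [|[|[|n2]]] /=;
  rewrite !(mulr0, mulr1, addr0, add0r) => h00 h11 h22 h12 h02 h01 h;
  by [exact: h00|exact: h11|exact: h22|exact: h12|exact: h02|exact: h01|exact: h].
Qed.

Lemma quadric_mpolyE p : p \is 2.-homog -> p = quadric_mpoly (form_of_mpoly p).
Proof.
move=> hom_p; apply/mpolyP => m.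
rewrite /quadric_mpoly -!mpolyXD !mcoeffD !mcoeffZ !mcoeffX !mnm3_eq !mnmDE !mnm1E /=.
have mdeg3 : mdeg m = (m 0%R + m 1%R + m 2%R)%N by rewrite mdegE; exact: sum3E.
have coef_m i j : (U_(i) + U_(j))%MM == m -> p@_m = p@_(U_(i) + U_(j)).
  by move/eqP->.
have [h00 h11 h22] := And3 (coef_m 0 0) (coef_m 1 1) (coef_m 2 2).
have [h12 h02 h01] := And3 (coef_m 1 2) (coef_m 0 2) (coef_m 0 1).
have := @dhomog_nemf_coeff _ _ _ _ _ m hom_p; rewrite /= mdeg3.
move: h00 h11 h22 h12 h02 h01; rewrite !mnm3_eq !mnmDE !mnm1E /=.
exact: degree2_cases.
Qed.

Lemma meval_linear u v : (linear_mpoly u).@[v 0] = dot3 u v.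
Proof.
by rewrite linear_mpolyE !mevalD !mevalZ !mevalXU.
Qed.

Lemma meval_quadric G v : (quadric_mpoly G).@[v 0] = tf_eval G v.
Proof.
rewrite /quadric_mpoly !mevalD !mevalZ !mevalM !mevalXU /tf_eval; ring.
Qed.

Lemma linear_mpoly_homog u : linear_mpoly u \is 1.-homog.
Proof.
by rewrite rpred_sum // => i _; rewrite rpredZ // dhomogX /= mdeg1.
Qed.

Lemma linear_mpoly_neq0 u : u != 0 -> linear_mpoly u != 0.
Proof.
apply: contra => /eqP L0; apply/eqP/rowP => i; rewrite mxE.
have := congr1 (fun p => p@_U_(i)) L0; rewrite mcoeff0 raddf_sum /= => <-.
rewrite (bigD1 i) //= mcoeffZ mcoeffX eqxx mulr1 big1 ?addr0 // => j ji.
rewrite mcoeffZ mcoeffX (_ : (_ == _) = false) ?mulr0 //; apply/negbTE; apply: contra ji.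
move/eqP/(congr1 (fun m : 'X_{1..3} => m j)); rewrite !mnm1E eqxx eq_sym.
by case: eqP.
Qed.

(** A linear form vanishes at the origin, and a unit does not. *)
Lemma linear_mpoly_nonunit u : linear_mpoly u \isn't a GRing.unit.
Proof.
apply/negP => /mulrV /(congr1 (meval ((0 : 'rV[K]_3) 0))).
rewrite mevalM meval_linear meval1 /dot3 !mxE !mulr0 !addr0 mul0r => /eqP.
by rewrite eq_sym oner_eq0.
Qed.

Definition tf_mul u v : ternary_form K := {|
  xx := u 0 0 * v 0 0; yy := u 0 1 * v 0 1; zz := u 0 2 * v 0 2;
  yz := u 0 1 * v 0 2 + u 0 2 * v 0 1; xz := u 0 0 * v 0 2 + u 0 2 * v 0 0;
  xy := u 0 0 * v 0 1 + u 0 1 * v 0 0 |}.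

Lemma linear_mpolyM u v : linear_mpoly u * linear_mpoly v =
  quadric_mpoly (tf_mul u v).
Proof.
by rewrite !linear_mpolyE /quadric_mpoly /= -!mul_mpolyC !mpolyCD !mpolyCM; ring.
Qed.

End FormPolynomials.

(** * Splitting of degenerate forms over an algebraically closed field *)

Section Degenerate.

Variable K : closedFieldType.
Hypothesis two0 : (2 : K) != 0.

Lemma closed_sqrt (a : K) : exists s, s ^+ 2 = a.
Proof.
have [s] := @solve_monicpoly K 2 (fun i => if i == 0%N then a else 0) isT.
by rewrite !big_ord_recr big_ord0 /= expr0 mulr1 mul0r addr0 add0r => <-; exists s.
Qed.

(** Completing the square, [4 a G = (2 a x + f y + e z)^2 - Q(y, z)]. The vanishing of the
    discriminant makes the binary form [Q] a square [(s y + t z)^2], and a difference of squares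
    factors. *)
Lemma degenerate_split_xx (G : ternary_form K) :
  xx G != 0 -> tf_disc G = 0 -> exists u v, G = tf_mul u v.
Proof.
case: G => a b c d e f /= a0; rewrite /tf_disc /= => disc0.
have four0 : (4 : K) != 0 by rewrite (_ : 4 = 2 * 2) ?mulf_neq0 //; ring.
have [s s2] := closed_sqrt (f ^+ 2 - 4 * a * b).
have [t [t2 st]] : exists t, t ^+ 2 = e ^+ 2 - 4 * a * c /\ s * t = f * e - 2 * a * d.
  have [t t2] := closed_sqrt (e ^+ 2 - 4 * a * c).
  (* The vanishing discriminant determines [s * t] up to sign, which the choice of the root [t] then
     corrects. *)
  have : (s * t == f * e - 2 * a * d) || (s * t == - (f * e - 2 * a * d)).
    rewrite -eqf_sqr exprMn s2 t2 -subr_eq0 -(mulr0 (4 * a)) -disc0.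
    by apply/eqP; ring.
  case/orP => /eqP st; first by exists t.
  by exists (- t); rewrite sqrrN mulrN st opprK.
exists (vec3 (2 * a) (f + s) (e + t)).
exists ((4 * a)^-1 *: vec3 (2 * a) (f - s) (e - t)).
rewrite /tf_mul !mxE /=; congr TernaryForm.
- by field; rewrite ?a0 ?two0 ?four0.
- transitivity ((f ^+ 2 - s ^+ 2) / (4 * a)); last by field; rewrite ?a0 ?two0 ?four0.
  by rewrite s2; field; rewrite ?a0 ?two0 ?four0.
- transitivity ((e ^+ 2 - t ^+ 2) / (4 * a)); last by field; rewrite ?a0 ?two0 ?four0.
  by rewrite t2; field; rewrite ?a0 ?two0 ?four0.
- transitivity ((2 * f * e - 2 * (s * t)) / (4 * a)); last first.
    by field; rewrite ?a0 ?two0 ?four0.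
  by rewrite st; field; rewrite ?a0 ?two0 ?four0.
- by field; rewrite ?a0 ?two0 ?four0.
- by field; rewrite ?a0 ?two0 ?four0.
Qed.

(** Exchanging variables reduces to [xx G != 0] unless all three square terms are 0. In that case
    the discriminant is the product of the cross coefficients; one of them is 0, and a variable
    factors out. *)
Lemma degenerate_split (G : ternary_form K) :
  tf_disc G = 0 -> exists u v, G = tf_mul u v.
Proof.
move=> disc0; have [a0|a0] := eqVneq (xx G) 0; last exact: degenerate_split_xx.
have [b0|b0] := eqVneq (yy G) 0; last first.
  have [|u [v []]] := @degenerate_split_xx
    (TernaryForm (yy G) (xx G) (zz G) (xz G) (yz G) (xy G)) b0.
    by rewrite -disc0 /tf_disc /=; ring.
  move=> e1 e2 e3 e4 e5 e6; exists (vec3 (u 0 1) (u 0 0) (u 0 2)).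
  exists (vec3 (v 0 1) (v 0 0) (v 0 2)); case: G e1 e2 e3 e4 e5 e6 {a0 b0 disc0} => /=.
  by move=> *; subst; rewrite /tf_mul !mxE /=; congr TernaryForm; ring.
have [c0|c0] := eqVneq (zz G) 0; last first.
  have [|u [v []]] := @degenerate_split_xx
    (TernaryForm (zz G) (yy G) (xx G) (xy G) (xz G) (yz G)) c0.
    by rewrite -disc0 /tf_disc /=; ring.
  move=> e1 e2 e3 e4 e5 e6; exists (vec3 (u 0 2) (u 0 1) (u 0 0)).
  exists (vec3 (v 0 2) (v 0 1) (v 0 0)); case: G e1 e2 e3 e4 e5 e6 {a0 b0 c0 disc0} => /=.
  by move=> *; subst; rewrite /tf_mul !mxE /=; congr TernaryForm; ring.
case: G disc0 a0 b0 c0 => a b c d e f; rewrite /tf_disc /= => disc0 a0 b0 c0; subst.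
have /eqP : d * e * f = 0 by rewrite -disc0; ring.
rewrite !mulf_eq0 -orbA => /or3P [] /eqP ->.
- exists (vec3 1 0 0), (vec3 0 f e).
  by rewrite /tf_mul !mxE /=; congr TernaryForm; ring.
- exists (vec3 0 1 0), (vec3 f 0 d).
  by rewrite /tf_mul !mxE /=; congr TernaryForm; ring.
- exists (vec3 0 0 1), (vec3 e d 0).
  by rewrite /tf_mul !mxE /=; congr TernaryForm; ring.
Qed.

End Degenerate.

Lemma map_quadric_mpoly (K L : fieldType) (phi : {rmorphism K -> L})
    (G : ternary_form K) :
  map_mpoly phi (quadric_mpoly G) =
  quadric_mpoly {| xx := phi (xx G); yy := phi (yy G); zz := phi (zz G);
    yz := phi (yz G); xz := phi (xz G); xy := phi (xy G) |}.
Proof.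
by rewrite /quadric_mpoly /= !rmorphD /= !map_mpolyZ !rmorphM /= !map_mpolyX.
Qed.

Lemma geom_irreducible_disc (F : finFieldType) (C : conic F) : odd #|F| ->
  geom_irreducible C -> tf_disc (form_of_mpoly C) != 0.
Proof.
move=> odd_F [_ _ irr]; apply/eqP => disc0.
set phi := to_alg_closure F in irr; set G := form_of_mpoly C in disc0.
pose phiG := {| xx := phi (xx G); yy := phi (yy G); zz := phi (zz G);
    yz := phi (yz G); xz := phi (xz G); xy := phi (xy G) |}.
have two0 : (2 : alg_closure F) != 0.
  by rewrite -(rmorph_nat phi) fmorph_eq0 finField_two_neq0.
have [|u [v defG]] := @degenerate_split _ two0 phiG.
  by rewrite -(rmorph0 phi) -disc0 /tf_disc /=; ring.
have := irr (linear_mpoly u) (linear_mpoly v).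
rewrite (quadric_mpolyE (curve_homog C)) map_quadric_mpoly -/phiG defG.
by rewrite linear_mpolyM => /(_ erefl) []; apply/negP/linear_mpoly_nonunit.
Qed.

(** * The logarithmic bound and the line missed by all the conics *)

Lemma exp2_lt_of_ln (R : realType) (l q : nat) : (0 < q)%N ->
  l%:R < (20 * ln 2)^-1 * ln q%:R :> R -> (2 ^ (20 * l) < q)%N.
Proof.
move=> q0; have ln2 : 0 < ln (2 : R) by rewrite ln_gt0 // ltr1n.
rewrite ltr_pdivlMl ?mulr_gt0 // => lt_l.
rewrite -(ltr_nat R) -ltr_ln ?posrE ?ltr0n ?expn_gt0 //.
by rewrite natrX lnXn // -[_ *+ (20 * l)]mulr_natr natrM mulrA [ln 2 * _]mulrC.
Qed.

Local Open Scope classical_set_scope.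

Theorem theorem1p2 (R : realType) :
  exists2 c0 : R, 0 < c0 &
    forall F : finFieldType, odd #|F| ->
    forall (l : nat) (C : 'I_l -> conic F),
      (forall i : 'I_l, geom_irreducible (C i)) ->
      l%:R < c0 * ln #|F|%:R ->
      ~ blocking_set (\bigcup_(i in [set: 'I_l]) rational_points (C i)).
Proof.
exists (20 * ln 2)^-1; first by rewrite invr_gt0 mulr_gt0 // ln_gt0 // ltr1n.
move=> F odd_F l C irrC lt_l blocking.
pose line u (u0 : u != 0) : proj_line F :=
  PlaneCurve (linear_mpoly_homog u) (linear_mpoly_neq0 u0).
(* Without conics the union is empty, and any line is missed. *)
have [l0|l0] := posnP l.
  have u0 : vec3 (1 : F) 0 0 != 0.
    by apply/eqP => /rowP /(_ 0); rewrite !mxE /= => /eqP; rewrite oner_eq0.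
  by have [p [[i _ _] _]] := blocking (line _ u0); case: i => i; rewrite l0.
have q0 : (0 < #|F|)%N by rewrite (cardD1 0) inE.
have [u u0 u_nonsq] := nonsquare_line odd_F
  (fun i => geom_irreducible_disc odd_F (irrC i)) l0 (exp2_lt_of_ln q0 lt_l).
(* A point of the conic [C i] on the line [u] would make its dual form a square at [u], against the
   choice of [u]. *)
have [p [[i _ Cp] Lp]] := blocking (line u u0).
pose v := vpick (sval p).
have v0 : v != 0 by rewrite vpick0 -dimv_eq0 (eqP (svalP p)).
have Gv : tf_eval (form_of_mpoly (C i)) v = 0.
  by rewrite -meval_quadric -quadric_mpolyE ?curve_homog // Cp ?memv_pick.
have uv : dot3 u v = 0 by rewrite -meval_linear; apply: Lp; apply: memv_pick.
have [y Dy] := tf_dual_sqr v0 Gv uv.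
by have := u_nonsq i v v0 Gv; apply/eqP; rewrite Dy qchar_sqr.
Qed.
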